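(* Let $A\in\mathbb{C}^{n\times n}$ be coninvolutory, i.e. $A\overline{A}=I_n$, and write $n=2m$ or $n=2m+1$. Let $\sigma_1\ge\cdots\ge\sigma_\nu>1$ be the singular values of $A$ that are $>1$ (with multiplicity), $S=\operatorname{diag}(\sigma_1,\dots,\sigma_\nu)$, and suppose $A$ has $\mu\ge0$ pairs $(1,1)$ of singular values $1$ associated with the singular triplets $(u_{\nu+j},v_{\nu+j},1)$ and $(\overline{v}_{\nu+j},\overline{u}_{\nu+j},1)$, $j=1,\dots,\mu$, where the $2\mu$ vectors $v_{\nu+1},\dots,v_{\nu+\mu},\overline{u}_{\nu+1},\dots,\overline{u}_{\nu+\mu}$ are orthonormal. Let $\eta=m-\nu-\mu$, and $\delta=\eta$ if $n=2m$, $\delta=\eta+1$ if $n=2m+1$. Then there are real numbers $\alpha_1,\dots,\alpha_{\delta+\eta}$, the phases of the remaining single singular triplets $(u_{\nu+\mu+j},e^{\imath\alpha_j}\overline{u}_{\nu+\mu+j},1)$, $j=1,\dots,\delta+\eta$, of $A$, such that with $D_\delta=\operatorname{diag}(e^{\imath\alpha_1},\dots,e^{\imath\alpha_\delta})$ and $E_\eta=\operatorname{diag}(e^{\imath\alpha_{\delta+1}},\dots,e^{\imath\alpha_{\delta+\eta}})$ the matrix $A$ is unitarily consimilar to the coninvolutory matrix $$T\Sigma=\begin{bmatrix} 0&0&0&S^{-1}&0&0 \\ 0&0&0&0&I_\mu&0 \\ 0&0&D_\delta&0&0&0 \\ S&0&0&0&0&0 \\ 0&I_\mu&0&0&0&0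 \\ 0&0&0&0&0&E_\eta \end{bmatrix}.$$ Moreover, $A$ is consimilar to the identity matrix $I_n$.
   Context: $\imath=\sqrt{-1}$; $\overline{X}$ is the entrywise complex conjugate and $X^H$ the conjugate transpose; $I_j$ is the $j\times j$ identity matrix. Matrices $A,B\in\mathbb{C}^{n\times n}$ are consimilar if there is a nonsingular $R\in\mathbb{C}^{n\times n}$ with $A=RB\overline{R}^{-1}$; they are unitarily consimilar if $R$ can be chosen unitary. A singular triplet of $A$ is $(u,v,\sigma)$ with $u$ a left and $v$ a right singular vector of $A$ for the singular value $\sigma$: $u,v\in\mathbb{C}^n$ are unit vectors with $Av=\sigma u$ and $A^Hu=\sigma v$. Here $\Sigma=\operatorname{diag}(S,I_\mu,I_\delta,S^{-1},I_\mu,I_\eta)$ and $$T=\begin{bmatrix} 0&0&I_{\nu+\mu}&0 \\ 0&D_\delta&0&0 \\ I_{\nu+\mu}&0&0&0 \\ 0&0&0&E_\eta \end{bmatrix}.$$ Empty blocks (size $0$) are allowed. *)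

(* Defs.v *)
From HB Require Import structures.
From mathcomp Require Import all_boot all_order all_algebra.
From mathcomp Require Import complex.
From mathcomp Require Import all_classical all_reals all_analysis.

Set Implicit Arguments.
Unset Strict Implicit.
Unset Printing Implicit Defensive.

Import Order.TTheory GRing.Theory Num.Theory.

Local Open Scope ring_scope.
Local Open Scope complex_scope.
Local Open Scope sesquilinear_scope.

(* Complex numbers are [R[i]] for [R : realType];
   [mxconj M] is the entrywise conjugate of [M] and [M ^t*] its
   conjugate transpose. *)

Notation mxconj M := (map_mx Num.conj M).

Definition expi (R : realType) (a : R) : R[i] := cos a +i* sin a.

Section ComplexMatrices.
Variable R : realType.
Local Notation C := R[i].

Definition coninvolutory n (A : 'M[C]_n) : Prop := A *m mxconj A = 1%:M.

Definition consimilar n (A B : 'M[C]_n) : Prop :=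
  exists2 Q : 'M[C]_n, Q \in unitmx & A = Q *m B *m invmx (mxconj Q).

Definition unitarily_consimilar n (A B : 'M[C]_n) : Prop :=
  exists2 Q : 'M[C]_n, Q \is unitarymx & A = Q *m B *m invmx (mxconj Q).

(* The roots of the characteristic polynomial, repeated according to their
   multiplicity, in unspecified order. *)
Definition eigenvalues n (A : 'M[C]_n) : seq C :=
  sval (closed_field_poly_normal (char_poly A)).

Lemma eigenvaluesP n (A : 'M[C]_n) :
  char_poly A = \prod_(x <- eigenvalues A) ('X - x%:P).
Proof.
rewrite /eigenvalues; case: closed_field_poly_normal => s /= {1}->.
by rewrite (monicP (char_poly_monic A)) scale1r.
Qed.

(* The square roots of the eigenvalues of A^H A with multiplicity, in
   nonincreasing order. These eigenvalues are real and nonnegative, so taking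
   [complex.Re] is only a change of type. *)
Definition singular_values n (A : 'M[C]_n) : seq R :=
  sort >=%R [seq Num.sqrt (complex.Re x) | x <- eigenvalues (A ^t* *m A)].

Definition singular_triplet n (A : 'M[C]_n) (u v : 'cV[C]_n) (s : R) : Prop :=
  [/\ 0 <= s, u ^t* *m u = 1%:M, v ^t* *m v = 1%:M,
      A *m v = s%:C *: u & A ^t* *m u = s%:C *: v].

Definition orthonormal_fam (I : eqType) n (w : I -> 'cV[C]_n) : Prop :=
  forall i j, (w i) ^t* *m w j = ((i == j)%:R)%:M.

Definition join_fam (I J : Type) n (f : I -> 'cV[C]_n) (g : J -> 'cV[C]_n)
  (k : I + J) : 'cV[C]_n := match k with inl i => f i | inr j => g j end.

Definition mxS nu (sigma : nu.-tuple R) : 'M[C]_nu :=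
  diag_mx (\row_j (tnth sigma j)%:C).

Definition phasesD delta eta (alpha : 'I_(delta + eta) -> R) : 'M[C]_delta :=
  diag_mx (\row_j expi (alpha (lshift eta j))).

Definition phasesE delta eta (alpha : 'I_(delta + eta) -> R) : 'M[C]_eta :=
  diag_mx (\row_j expi (alpha (rshift delta j))).

(* Rows and columns of the next three matrices are grouped as
   ((nu + mu) + delta) + ((nu + mu) + eta). *)
Definition mxSigma nu mu delta eta (S : 'M[C]_nu) :
    'M[C]_(nu + mu + delta + (nu + mu + eta)) :=
  block_mx
    (block_mx (block_mx S 0 0 1%:M) 0
              0                     1%:M)
    0
    0
    (block_mx (block_mx (invmx S) 0 0 1%:M) 0
              0                             1%:M).

Definition mxT nu mu delta eta (D : 'M[C]_delta) (E : 'M[C]_eta) :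
    'M[C]_(nu + mu + delta + (nu + mu + eta)) :=
  block_mx (block_mx 0    0 0 D) (block_mx 1%:M 0 0 0)
           (block_mx 1%:M 0 0 0) (block_mx 0    0 0 E).

Definition mxTSigma nu mu delta eta
    (S : 'M[C]_nu) (D : 'M[C]_delta) (E : 'M[C]_eta) :
    'M[C]_(nu + mu + delta + (nu + mu + eta)) :=
  block_mx
    (block_mx 0 0
              0 D)
    (block_mx (block_mx (invmx S) 0 0 1%:M) 0
              0                             0)
    (block_mx (block_mx S 0 0 1%:M) 0
              0                     0)
    (block_mx 0 0
              0 E).

End ComplexMatrices.

Arguments mxSigma {R nu} mu delta eta S.
Arguments mxT {R} nu mu {delta eta} D E.
Arguments mxTSigma {R nu} mu {delta eta} S D E.

(* Main.v *)
Require Import Defs.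
From HB Require Import structures.
From mathcomp Require Import all_boot all_order all_algebra.
From mathcomp Require Import complex.
From mathcomp Require Import all_classical all_reals all_analysis.
From mathcomp Require Import zify ring.

(** Write P = A^H A and J x = conj(A x).  Coninvolutivity says exactly that the
    antilinear map J is an involution.  It is not isometric, but
    <J x, J y> = conj <x, P y> ([gram_conjact]), and P J P = J
    ([gram_conjact_gram]), so J carries the eigenspace of P at s^2 onto the one
    at s^-2: singular values other than 1 come in pairs (s, s^-1).

    Let V1 consist of orthonormal eigenvectors of P for the squares of the
    singular values > 1, listed in the order of sigma.  Put F = [V1, V],
    G = J F L^-1 = [J V1 S^-1, conj U] where L = diag(S, I) and where U, V hold
    the given pairs (1, 1).  Eigenvectors of P for distinct eigenvalues are
    orthogonal, so B = [F, G] has orthonormal columns, and its span is stable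
    under J and P; hence so is its orthogonal complement W.

    On W the operator P is the identity, and no count of eigenvalues is needed:
    W is orthogonal to all eigenvectors of eigenvalue > 1, so <y, P y> <= <y, y>
    on W; the map J exchanges the two sides of this inequality, so equality
    holds throughout W, which forces P y = y ([gram_perp_id]).  Hence J is an
    isometric antilinear involution of W, in other words a real structure, and
    W has an orthonormal basis Y of vectors fixed by J
    ([fixed_orthonormal_completion]).

    A fixed vector y satisfies A y = conj y and A^H (conj y) = y: it is the
    right vector of a single singular triplet (conj y, y, 1), and its phase is
    0.  All the phases can therefore be taken equal to 0.  Finally
    J F = G L, J G = F L^-1, J Y = Y is, in matrix form, the unitary
    consimilarity ([unitary_consimilar_swap]).

    For the consimilarity with the identity, Q = c A + conj(c) I satisfies
    A conj(Q) = Q for every scalar c, and Q is invertible as soon as -conj(c)/c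
    avoids the finitely many eigenvalues of A. *)

Set Implicit Arguments.
Unset Strict Implicit.
Unset Printing Implicit Defensive.

Import Order.TTheory GRing.Theory Num.Theory.
Local Open Scope ring_scope.
Local Open Scope complex_scope.
Local Open Scope sesquilinear_scope.

(** * Conjugate transposes and Gram matrices *)

Lemma mxconjK (C : numClosedFieldType) m n (X : 'M[C]_(m, n)) :
  mxconj (mxconj X) = X.
Proof. by apply/matrixP => i j; rewrite !mxE conjCK. Qed.

Lemma trmxC_mul (C : numClosedFieldType) m n p
  (X : 'M[C]_(m, n)) (Y : 'M[C]_(n, p)) : (X *m Y) ^t* = Y ^t* *m X ^t*.
Proof. by rewrite trmx_mul map_mxM. Qed.

Lemma mxconj_trmxC (C : numClosedFieldType) m n (X : 'M[C]_(m, n)) :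
  mxconj (X ^t*) = (mxconj X) ^t*.
Proof. by rewrite map_trmx. Qed.

Lemma trmxC_row (C : numClosedFieldType) n p q
  (X : 'M[C]_(n, p)) (Y : 'M[C]_(n, q)) :
  (row_mx X Y) ^t* = col_mx (X ^t*) (Y ^t*).
Proof. by rewrite tr_row_mx map_col_mx. Qed.

Lemma gram_row (C : numClosedFieldType) n p q p' q' (X : 'M[C]_(n, p))
  (Y : 'M[C]_(n, q)) (X' : 'M[C]_(n, p')) (Y' : 'M[C]_(n, q')) :
  (row_mx X Y) ^t* *m row_mx X' Y' =
  block_mx (X ^t* *m X') (X ^t* *m Y') (Y ^t* *m X') (Y ^t* *m Y').
Proof. by rewrite trmxC_row mul_col_row. Qed.

Lemma row_perp (C : numClosedFieldType) n p q r (X : 'M[C]_(n, p))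
  (Y : 'M[C]_(n, q)) (Z : 'M[C]_(n, r)) :
  (row_mx X Y) ^t* *m Z = 0 -> X ^t* *m Z = 0 /\ Y ^t* *m Z = 0.
Proof.
move/eqP; rewrite trmxC_row mul_col_mx col_mx_eq0.
by case/andP => /eqP -> /eqP ->.
Qed.

Lemma gram_sym0 (C : numClosedFieldType) n p q
  (X : 'M[C]_(n, p)) (Y : 'M[C]_(n, q)) :
  X ^t* *m Y = 0 -> Y ^t* *m X = 0.
Proof.
by move=> h; rewrite -[X in _ *m X]trmxCK -trmxC_mul h trmx0 map_mx0.
Qed.

Lemma gramE (C : numClosedFieldType) n (x : 'cV[C]_n) :
  (x ^t* *m x) 0 0 = \sum_i `|x i 0| ^+ 2.
Proof. by rewrite mxE; apply: eq_bigr => i _; rewrite !mxE mulrC -normCK. Qed.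

Lemma gram_ge0 (C : numClosedFieldType) n (x : 'cV[C]_n) :
  0 <= (x ^t* *m x) 0 0.
Proof. by rewrite gramE sumr_ge0 // => i _; rewrite exprn_ge0. Qed.

Lemma gram_eq0 (C : numClosedFieldType) n (x : 'cV[C]_n) :
  (x ^t* *m x) 0 0 = 0 -> x = 0.
Proof.
rewrite gramE => /eqP; rewrite psumr_eq0; last by move=> i _; rewrite exprn_ge0.
move=> /allP h; apply/matrixP => i j; rewrite ord1 mxE.
by apply/eqP; have := h i (mem_index_enum _); rewrite /= expf_eq0 normr_eq0.
Qed.

(** * The antilinear involution attached to a coninvolutory matrix *)

Section Conjact.
Variables (C : numClosedFieldType) (n : nat) (A : 'M[C]_n).
Local Notation P := (A ^t* *m A).

(** The antilinear map J, applied to each column of [X]; vectors fixed by it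
    are those with [A x = conj x]. *)
Definition conjact k (X : 'M[C]_(n, k)) := mxconj (A *m X).

Lemma conjactM k l (X : 'M[C]_(n, k)) (Y : 'M[C]_(k, l)) :
  conjact (X *m Y) = conjact X *m mxconj Y.
Proof. by rewrite /conjact mulmxA map_mxM. Qed.

Lemma conjact_row k l (X : 'M[C]_(n, k)) (Y : 'M[C]_(n, l)) :
  conjact (row_mx X Y) = row_mx (conjact X) (conjact Y).
Proof. by rewrite /conjact mul_mx_row map_row_mx. Qed.

(** J is isometric, up to conjugation, for the form given by A^H A instead of
    the standard one. *)
Lemma gram_conjact k l (X : 'M[C]_(n, k)) (Y : 'M[C]_(n, l)) :
  (conjact X) ^t* *m conjact Y = mxconj (X ^t* *m (P *m Y)).
Proof.
by rewrite -mxconj_trmxC -map_mxM trmxC_mul !mulmxA.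
Qed.

Lemma herm_gram : P ^t* = P.
Proof. by rewrite trmxC_mul trmxCK. Qed.

Hypothesis hA : A *m mxconj A = 1%:M.

Lemma conjactK k (X : 'M[C]_(n, k)) : conjact (conjact X) = X.
Proof.
by rewrite /conjact map_mxM mxconjK mulmxA (mulmx1C hA) mul1mx.
Qed.

(** Applied to an eigenvector of A^H A with eigenvalue s, this says that its
    image under J is an eigenvector with eigenvalue 1/s. *)
Lemma gram_conjact_gram k (X : 'M[C]_(n, k)) :
  P *m conjact (P *m X) = conjact X.
Proof.
rewrite /conjact !map_mxM mxconj_trmxC.
rewrite -[RHS]mul1mx -[1%:M](_ : A ^t* *m (mxconj A)^t* = _).
  by rewrite -!mulmxA; congr (_ *m _); rewrite !mulmxA hA mul1mx.
by rewrite -trmxC_mul (mulmx1C hA) trmx1 map_mx1.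
Qed.

(** When L is diagonal, F consists of orthonormal eigenvectors with eigenvalues
    L^2; the vectors J F are then orthogonal of norms L, so that dividing by L
    gives an orthonormal family G. *)
Lemma conjact_rescaled k (F G : 'M[C]_(n, k)) (L L' : 'M[C]_k) :
  F ^t* *m F = 1%:M -> P *m F = F *m L *m L -> L *m L' = 1%:M ->
  mxconj L = L -> mxconj L' = L' -> L' ^T = L' -> G = conjact F *m L' ->
  [/\ conjact F = G *m L, conjact G = F *m L', P *m conjact F = G *m L',
      P *m conjact G = F *m L & G ^t* *m G = 1%:M].
Proof.
move=> FF PF LL' rL rL' sL' GE.
have JF : conjact F = G *m L by rewrite GE -mulmxA (mulmx1C LL') mulmx1.
have JG : conjact G = F *m L' by rewrite GE conjactM conjactK rL'.
split=> //.
- (* F is written as P applied to something, so that P J P = J applies. *)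
  have FE : F = P *m (F *m L' *m L').
    by rewrite !mulmxA PF -(mulmxA _ L L') LL' mulmx1 -mulmxA LL' mulmx1.
  rewrite {1}FE gram_conjact_gram !conjactM rL' JF -(mulmxA G) LL'.
  by rewrite mulmx1.
- by rewrite JG mulmxA PF -(mulmxA _ L L') LL' mulmx1.
rewrite GE trmxC_mul sL' rL' -mulmxA (mulmxA _ (conjact F)) gram_conjact PF.
rewrite !mulmxA FF mul1mx map_mxM rL !mulmxA (mulmx1C LL') mul1mx.
exact: LL'.
Qed.

(** Since J is an involution, B = J (J B), and [gram_conjact] turns B^H (J Y)
    into the conjugate of (P J B)^H Y; so it is the stability of the span of B
    under P J, not under J, that makes the complement J-stable. *)
Lemma conjact_perp k l (B : 'M[C]_(n, k)) K (Y : 'M[C]_(n, l)) :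
  P *m conjact B = B *m K -> B ^t* *m Y = 0 -> B ^t* *m conjact Y = 0.
Proof.
move=> hB hY; rewrite -[B in LHS]conjactK gram_conjact mulmxA.
rewrite -herm_gram -trmxC_mul hB trmxC_mul -mulmxA hY mulmx0.
exact: map_mx0.
Qed.

(** J maps the complement of B to itself and exchanges <y, P y> and <y, y>
    there: an inequality between these forms valid on the whole complement
    is an equality. *)
Lemma gram_perp_id k (B : 'M[C]_(n, k)) K :
  P *m conjact B = B *m K ->
  (forall y : 'cV[C]_n, B ^t* *m y = 0 ->
     (y ^t* *m (P *m y)) 0 0 <= (y ^t* *m y) 0 0
       ?= iff (P *m y == y)) ->
  forall y : 'cV[C]_n, B ^t* *m y = 0 -> P *m y = y.
Proof.
move=> hB le1 y hy; apply/eqP; rewrite -(le1 y hy).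
have hz := conjact_perp hB hy.
have [hle _] := le1 _ hz; have [hle' _] := le1 _ hy.
have real_gram (x : 'cV[C]_n) : (x ^t* *m x) 0 0 \is Num.real.
  by rewrite ger0_real ?gram_ge0.
have e1 : (conjact y ^t* *m conjact y) 0 0 = (y ^t* *m (P *m y)) 0 0.
  rewrite gram_conjact mxE; apply: CrealP.
  by rewrite mulmxA mulmxA -mulmxA -trmxC_mul real_gram.
have e2 : (conjact y ^t* *m (P *m conjact y)) 0 0 = (y ^t* *m y) 0 0.
  rewrite -[_ *m _]mxconjK -gram_conjact conjactK mxE; apply: CrealP.
  exact: real_gram.
by rewrite eq_le hle' -e1 -e2.
Qed.

Lemma exists_perp k (B : 'M[C]_(n, k)) : (k < n)%N ->
  exists2 y : 'cV[C]_n, y != 0 & B ^t* *m y = 0.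
Proof.
move=> ltkn; pose M := mxconj B.
have : kermx M != 0.
  rewrite -mxrank_eq0 mxrank_ker -lt0n subn_gt0.
  exact: leq_ltn_trans (rank_leq_col _) ltkn.
case/rowV0Pn => z /sub_kermxP hz nz0; exists z^T.
  by apply: contra nz0 => /eqP h; rewrite -[z]trmxK h trmx0.
by rewrite -map_trmx -trmx_mul hz trmx0.
Qed.

(** Averaging y with J y gives a fixed vector; it vanishes only if J y = - y,
    and then i y is fixed because J is antilinear.  Rescaling by a real number
    keeps it fixed. *)
Lemma exists_fixed_unit k (B : 'M[C]_(n, k)) K : (k < n)%N ->
  P *m conjact B = B *m K ->
  exists w : 'cV[C]_n, [/\ B ^t* *m w = 0, w ^t* *m w = 1%:M & conjact w = w].
Proof.
move=> ltkn hB; have [y ny0 hy] := exists_perp B ltkn.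
have conjactZ (c : C) (x : 'cV[C]_n) : conjact (c *: x) = c^* *: conjact x.
  by rewrite /conjact -scalemxAr map_mxZ.
have conjactD (x z : 'cV[C]_n) : conjact (x + z) = conjact x + conjact z.
  by rewrite /conjact mulmxDr map_mxD.
have [w [nw0 hw fw]] : exists w : 'cV[C]_n,
    [/\ w != 0, B ^t* *m w = 0 & conjact w = w].
  have [s0|ns0] := eqVneq (y + conjact y) 0; last first.
    exists (y + conjact y); split=> //.
      by rewrite mulmxDr hy (conjact_perp hB hy) addr0.
    by rewrite conjactD conjactK addrC.
  exists ('i *: y); split; first by rewrite scaler_eq0 negb_or neq0Ci.
    by rewrite -scalemxAr hy scaler0.
  rewrite conjactZ conjCi (_ : conjact y = - y) ?scalerN ?scaleNr ?opprK //.
  by apply/eqP; rewrite -addr_eq0 addrC s0.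
pose a := (w ^t* *m w) 0 0.
have a0 : 0 < a.
  rewrite lt_def gram_ge0 andbT; apply: contra nw0 => /eqP h.
  by rewrite (gram_eq0 h).
have c0 : 0 <= (sqrtC a)^-1 by rewrite invr_ge0 sqrtC_ge0 ltW.
exists ((sqrtC a)^-1 *: w); split.
- by rewrite -scalemxAr hw scaler0.
- rewrite [(_ *: w)^T]linearZ /= map_mxZ -scalemxAl -scalemxAr scalerA.
  rewrite [w ^t* *m w]mx11_scalar -/a scale_scalar_mx; congr (_%:M).
  rewrite /= conj_Creal ?ger0_real // -expr2 exprVn sqrtCK mulVf //.
  by rewrite gt_eqF.
- by rewrite conjactZ fw conj_Creal // ger0_real.
Qed.

(** Gram-Schmidt with fixed vectors: each new vector w satisfies P w = w and
    J w = w, so that B extended by w still has a complement stable under J. *)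
Lemma fixed_orthonormal_completion r k (B : 'M[C]_(n, k)) K :
  (k + r)%N = n ->
  B ^t* *m B = 1%:M -> P *m conjact B = B *m K ->
  (forall y : 'cV[C]_n, B ^t* *m y = 0 -> P *m y = y) ->
  exists W : 'M[C]_(n, r),
    [/\ B ^t* *m W = 0, W ^t* *m W = 1%:M & conjact W = W].
Proof.
elim: r k B K => [|r IH] k B K hk hBB hB hP.
  by exists 0; split; rewrite ?[LHS]thinmx0 ?mulmx0 //; apply/matrixP=> i [].
have ltkn : (k < n)%N by rewrite -hk -addSnnS leq_addr.
have [w [hw ww fw]] := exists_fixed_unit ltkn hB.
have wB := gram_sym0 hw.
have [||||W [hW WW fW]] :=
    IH (k + 1)%N (row_mx B w) (block_mx K 0 0 1%:M).
- by rewrite -addnA add1n.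
- by rewrite gram_row hBB hw wB ww -scalar_mx_block.
- rewrite conjact_row fw mul_mx_row hB (hP _ hw) mul_row_block.
  by rewrite !mulmx0 mulmx1 addr0 add0r.
- by move=> y /row_perp[+ _]; apply: hP.
have [hBW hwW] := row_perp hW.
exists (row_mx w W : 'M[C]_(n, 1 + r)); split.
- by rewrite (mul_mx_row _ w W) hw hBW (row_mx0 _ _ 1 r).
- rewrite (gram_row w W w W) ww WW hwW (gram_sym0 hwW).
  by rewrite -(scalar_mx_block 1 r).
- by rewrite (conjact_row w W) fw fW.
Qed.

End Conjact.

(** * Spectral decomposition of A^H A and singular values *)

Lemma char_poly_similar (F : fieldType) n (P V D : 'M[F]_n) :
  V \in unitmx -> P *m V = V *m D -> char_poly P = char_poly D.
Proof.
move=> uV hPV; pose V' := map_mx polyC V.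
have nz : \det V' != 0.
  by rewrite det_map_mx polyC_eq0 -unitfE -unitmxE.
apply: (mulIf nz); rewrite -det_mulmx [RHS]mulrC -det_mulmx; congr (\det _).
rewrite /char_poly_mx mulmxBl mulmxBr -!map_mxM hPV.
by rewrite scalar_mxC.
Qed.

Lemma gram_spectral (C : numClosedFieldType) n (A : 'M[C]_n) :
  exists (V : 'M[C]_n) (d : 'rV[C]_n),
    [/\ V ^t* *m V = 1%:M, A ^t* *m A *m V = V *m diag_mx d,
        forall i, 0 <= d 0 i &
        char_poly (A ^t* *m A) = \prod_i ('X - (d 0 i)%:P)].
Proof.
set P := A ^t* *m A; pose U := spectralmx P; pose d := spectral_diag P.
have hU : U \is unitarymx := spectral_unitarymx P.
have hP : P = U ^t* *m diag_mx d *m U.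
  rewrite -(invmx_unitary hU); apply/orthomx_spectralP/normalmxP.
  by rewrite herm_gram.
have UU : U *m U ^t* = 1%:M by apply/unitarymxP.
have hV : P *m U ^t* = U ^t* *m diag_mx d by rewrite hP -!mulmxA UU mulmx1.
exists (U ^t*), d; split=> //; first by rewrite trmxCK.
  move=> i; have <- : (U *m P *m U ^t*) i i = d 0 i.
    by rewrite -mulmxA hV mulmxA UU mul1mx mxE eqxx.
  have -> : U *m P *m U ^t* = (A *m U ^t*) ^t* *m (A *m U ^t*).
    by rewrite trmxC_mul trmxCK /P !mulmxA.
  rewrite mxE sumr_ge0 // => j _.
  by rewrite 2!mxE mulrC mul_conjC_ge0.
have -> : char_poly P = char_poly (diag_mx d).
  by apply: char_poly_similar hV; rewrite unitarymx_unit ?trmxC_unitary.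
rewrite char_poly_trig ?diag_mx_is_trig //.
by apply: eq_bigr => i _; rewrite mxE eqxx.
Qed.

Section SpectralBasis.
Variables (C : numClosedFieldType) (n : nat) (P V : 'M[C]_n) (d : 'rV[C]_n).
Hypotheses (hV : V ^t* *m V = 1%:M) (hP : P *m V = V *m diag_mx d).

(** In the eigenbasis V the two forms are the sums of d_i |c_i|^2 and of
    |c_i|^2, where c_i = 0 unless d_i <= 1; equality means d_i c_i = c_i for all
    i, that is P y = y. *)
Lemma perp_quad_leif (y : 'cV[C]_n) :
  (forall i, 0 <= d 0 i) ->
  (forall i, 1 < d 0 i -> (V ^t* *m y) i 0 = 0) ->
  (y ^t* *m (P *m y)) 0 0 <= (y ^t* *m y) 0 0 ?= iff (P *m y == y).
Proof.
move=> d0; have [c hc] : exists c, y = V *m c.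
  by exists (V ^t* *m y); rewrite mulmxA (mulmx1C hV) mul1mx.
have -> : V ^t* *m y = c by rewrite hc mulmxA hV mul1mx.
move=> hy.
have -> : (y ^t* *m y) 0 0 = \sum_i `|c i 0| ^+ 2.
  by rewrite hc trmxC_mul mulmxA -(mulmxA _ _ V) hV mulmx1 gramE.
have -> : (y ^t* *m (P *m y)) 0 0 = \sum_i d 0 i * `|c i 0| ^+ 2.
  rewrite hc trmxC_mul !mulmxA -(mulmxA _ P V) hP.
  rewrite mulmxA -(mulmxA _ _ V) hV mulmx1 -mulmxA mul_diag_mx mxE.
  by apply: eq_bigr => i _; rewrite !mxE mulrCA [in RHS]normCK [c i 0 * _]mulrC.
have -> : (P *m y == y) = [forall i, d 0 i * c i 0 == c i 0].
  apply/eqP/forallP => [h i|h].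
    have : V ^t* *m (P *m y) = V ^t* *m y by rewrite h.
    rewrite hc !mulmxA -(mulmxA _ P V) hP mulmxA hV !mul1mx mul_diag_mx.
    by move=> /matrixP/(_ i 0); rewrite mxE => ->.
  rewrite hc mulmxA hP -mulmxA; congr (_ *m _); apply/matrixP => i j.
  by rewrite ord1 mul_diag_mx mxE (eqP (h i)).
suff le i : d 0 i * `|c i 0| ^+ 2 <= `|c i 0| ^+ 2
               ?= iff (d 0 i * c i 0 == c i 0).
  by apply: leif_sum => i _; apply: le.
have [lt1|] := boolP (1 < d 0 i).
  by rewrite (hy i lt1) normr0 expr2 !mulr0 eqxx; apply/leif_refl.
rewrite -real_leNgt ?ger0_real // => le1; split.
  by rewrite ler_piMl ?exprn_ge0.
have [->|nz] := eqVneq (c i 0) 0; first by rewrite normr0 expr2 !mulr0 !eqxx.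
rewrite -[X in _ == X]mul1r -[X in _ = (_ == X)]mul1r.
by rewrite (inj_eq (mulIf _)) ?expf_neq0 ?normr_eq0 // (inj_eq (mulIf nz)).
Qed.

End SpectralBasis.

Lemma eigen_perp (C : numClosedFieldType) n p q (P : 'M[C]_n)
  (X : 'M[C]_(n, p)) (Y : 'M[C]_(n, q)) (a : 'rV[C]_p) (b : 'rV[C]_q) :
  P ^t* = P -> (forall i, a 0 i \is Num.real) ->
  P *m X = X *m diag_mx a -> P *m Y = Y *m diag_mx b ->
  (forall i j, a 0 i != b 0 j) -> X ^t* *m Y = 0.
Proof.
move=> hP ra hX hY neq; apply/matrixP => i j; rewrite [RHS]mxE.
have : (diag_mx a) ^t* *m (X ^t* *m Y) = X ^t* *m Y *m diag_mx b.
  by rewrite mulmxA -trmxC_mul -hX trmxC_mul hP -!mulmxA hY.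
rewrite tr_diag_mx map_diag_mx mul_diag_mx mul_mx_diag => /matrixP /(_ i j).
rewrite [LHS]mxE [RHS]mxE [map_mx _ a 0 i]mxE /= conj_Creal // mulrC => /eqP.
by rewrite -subr_eq0 -mulrBr mulf_eq0 subr_eq0 (negPf (neq i j)) orbF => /eqP.
Qed.

Lemma perm_map_lift (S T : eqType) (f : S -> T) (s : seq T) (t : seq S) :
  perm_eq s [seq f x | x <- t] ->
  exists2 t', perm_eq t' t & s = [seq f x | x <- t'].
Proof.
elim: s t => [|a s IH] t hst.
  exists [::] => //; move: (perm_size hst).
  by rewrite size_map; case: t {hst}.
have /mapP[x xt ax] : a \in [seq f x | x <- t].
  by rewrite -(perm_mem hst) mem_head.
have htx := perm_to_rem xt.
have := perm_trans hst (perm_map f htx).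
rewrite /= -ax perm_cons => /IH[t' h ->].
exists (x :: t'); last by rewrite /= -ax.
by rewrite perm_sym (perm_trans htx) // perm_cons perm_sym.
Qed.

(** Locates the singular values > 1 in an arbitrary diagonalization of A^H A.
    The identity of characteristic polynomials only compares multisets, whence
    the choice of the index f j of an eigenvalue equal to sigma_j^2. *)
Lemma gt1_singular_index (R : realType) n nu (A : 'M[R[i]]_n)
  (sigma : nu.-tuple R) (d : 'rV[R[i]]_n) :
  sigma = [seq s <- singular_values A | 1 < s] :> seq R ->
  (forall i, 0 <= d 0 i) ->
  char_poly (A ^t* *m A) = \prod_i ('X - (d 0 i)%:P) ->
  exists f : 'I_nu -> 'I_n,
    [/\ injective f, forall j, d 0 (f j) = (tnth sigma j)%:C ^+ 2 &
        forall i, 1 < d 0 i -> exists j, f j = i].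
Proof.
move=> hs d0 hchar; pose g i := Num.sqrt (complex.Re (d 0 i)).
have dE i : d 0 i = (complex.Re (d 0 i))%:C.
  have := d0 i; rewrite lecE /= => /andP[/eqP h _].
  by case: (d 0 i) h => a b /= ->.
have re0 i : 0 <= complex.Re (d 0 i).
  by have := d0 i; rewrite lecE => /andP[].
have gE i : d 0 i = (g i)%:C ^+ 2.
  by rewrite -rmorphXn /= sqr_sqrtr // -dE.
have g1 i : (1 < g i) = (1 < d 0 i).
  rewrite gE -rmorphXn /= -[1 in RHS]/(1%:C) ltcR.
  by rewrite expr_gt1 // sqrtr_ge0.
have hperm : perm_eq (eigenvalues (A ^t* *m A)) [seq d 0 i | i : 'I_n].
  apply: prod_XsubC_eq; rewrite -eigenvaluesP hchar.
  by rewrite big_map enumT.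
have : perm_eq sigma [seq g i | i <- [seq i <- enum 'I_n | 1 < g i]].
  rewrite hs -filter_map; apply: perm_filter.
  rewrite /singular_values perm_sort.
  by rewrite (perm_trans (perm_map _ hperm)) // -map_comp.
case/perm_map_lift => t ht hst.
have st : size t == nu by rewrite -(size_map g) -hst size_tuple.
have ut : uniq t by rewrite (perm_uniq ht) filter_uniq ?enum_uniq.
exists (tnth (Tuple st)); split.
- by apply/tuple_uniqP.
- move=> j; rewrite gE; congr (_%:C ^+ 2).
  by rewrite (tnth_nth 1) hst (nth_map (tnth (Tuple st) j)) ?(eqP st) //
             -(tnth_nth _ (Tuple st)).
- move=> i; rewrite -g1 => hi.
  have : i \in Tuple st by rewrite (perm_mem ht) mem_filter hi mem_enum.
  by case/tnthP => j ->; exists j.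
Qed.

(** * Consimilarity *)

(** The scalars c = 1 + t i with t natural have pairwise distinct ratios
    -conj(c)/c, one of which is not an eigenvalue of A. *)
Lemma coninvolutory_consimilar1 (C : numClosedFieldType) n (A : 'M[C]_n) :
  A *m mxconj A = 1%:M ->
  exists2 Q, Q \in unitmx & A = Q *m 1%:M *m invmx (mxconj Q).
Proof.
move=> hA; pose c t : C := 1 + t%:R * 'i.
have cJ t : (c t)^*%R = 1 - t%:R * 'i.
  by rewrite rmorphD rmorph1 rmorphM /= conjCi conjC_nat mulrN.
have c0 t : c t != 0.
  have : c t * (c t)^*%R != 0.
    have -> : c t * (c t)^*%R = (1 + t ^ 2)%N%:R.
      rewrite cJ mulrC -subr_sqr expr1n exprMn sqrCi mulrN1 opprK.
      by rewrite natrD natrX.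
    by rewrite pnatr_eq0.
  by rewrite mulf_eq0 negb_or => /andP[].
pose z t := - ((c t)^*%R / c t).
have injz : injective z.
  move=> s t /oppr_inj /eqP; rewrite eqr_div // !cJ -subr_eq0.
  rewrite (_ : _ - _ = ((t%:R - s%:R) * 2%:R) * 'i); last by rewrite /c; ring.
  rewrite mulf_eq0 (negPf (neq0Ci C)) orbF mulf_eq0 pnatr_eq0 orbF subr_eq0.
  by rewrite eqr_nat => /eqP.
have [t hz] : exists t, ~~ root (char_poly A) (z t).
  pose s := [seq z t | t <- iota 0 n.+1].
  have : ~~ all (root (char_poly A)) s.
    apply/negP => /max_poly_roots h.
    have := h (monic_neq0 (char_poly_monic A)).
    by rewrite map_inj_uniq // iota_uniq size_char_poly size_map size_iota ltnn
       => /(_ isT).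
  by case/allPn => _ /mapP[t _ ->] h; exists t.
pose Q := c t *: A + (c t)^*%R *: 1%:M.
have uQ : Q \in unitmx.
  have -> : Q = c t *: (A - (z t)%:M).
    rewrite /Q scalerBr -(scalemx1 _ (z t)) scalerA /z mulrN mulrC divfK //.
    by rewrite scaleNr opprK.
  rewrite unitmxZ ?unitfE // -row_free_unit -kermx_eq0.
  by move: hz; rewrite -eigenvalue_root_char negbK.
have hQ : A *m mxconj Q = Q.
  rewrite map_mxD !map_mxZ map_mx1 mulmxDr -!scalemxAr hA mulmx1 /= conjCK.
  by rewrite addrC.
exists Q; first exact: uQ.
by rewrite mulmx1 -{1}hQ mulmxK // map_unitmx.
Qed.

(** The columns of X = [F, Y, G, Z] are the conjugates of those of Q, and the
    hypotheses say J X = X M with M the real block matrix of the statement.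
    Conjugating, A X = conj(X) M. *)
Lemma unitary_consimilar_swap (C : numClosedFieldType) p q r
  (A : 'M[C]_(p + q + (p + r))) (F G : 'M[C]_(_, p))
  (Y : 'M[C]_(_, q)) (Z : 'M[C]_(_, r)) (L L' : 'M[C]_p) :
  conjact A F = G *m L -> conjact A G = F *m L' ->
  conjact A Y = Y -> conjact A Z = Z -> mxconj L = L -> mxconj L' = L' ->
  (row_mx (row_mx F Y) (row_mx G Z)) ^t* *m
     row_mx (row_mx F Y) (row_mx G Z) = 1%:M ->
  exists2 Q, Q \is unitarymx &
    A = Q *m block_mx (block_mx 0 0 0 (1%:M : 'M[C]_q)) (block_mx L' 0 0 0)
                      (block_mx L 0 0 0) (block_mx 0 0 0 (1%:M : 'M[C]_r))
          *m invmx (mxconj Q).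
Proof.
set X := row_mx (row_mx F Y) (row_mx G Z); set M := block_mx _ _ _ _.
move=> hF hG hY hZ rL rL' hX.
have rM : mxconj M = M.
  by rewrite /M !map_block_mx !map_mx0 !map_mx1 rL rL'.
have XM : X *m M = conjact A X.
  rewrite !conjact_row hF hG hY hZ /X /M mul_row_block !mul_row_block.
  by rewrite !mulmx0 !mulmx1 !addr0 !add0r add_row_mx addr0 add0r
             add_row_mx addr0 add0r.
exists (mxconj X).
  by rewrite conjC_unitary -trmxC_unitary; apply/unitarymxP; rewrite trmxCK.
rewrite -[M]rM -map_mxM XM mxconjK mxconjK mulmxK //.
by case/mulmx1_unit: hX.
Qed.

Lemma gram_interleave (C : numClosedFieldType) n p q r
  (F G : 'M[C]_(n, p)) (Y : 'M[C]_(n, q)) (Z : 'M[C]_(n, r)) :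
  (row_mx F G) ^t* *m row_mx F G = 1%:M ->
  (row_mx F G) ^t* *m row_mx Y Z = 0 ->
  (row_mx Y Z) ^t* *m row_mx Y Z = 1%:M ->
  (row_mx (row_mx F Y) (row_mx G Z)) ^t* *m
     row_mx (row_mx F Y) (row_mx G Z) = 1%:M.
Proof.
rewrite !gram_row (scalar_mx_block p) (scalar_mx_block q).
move=> /eq_block_mx[FF FG GF GG] + /eq_block_mx[YY YZ ZY ZZ].
rewrite -block_mx0 => /eq_block_mx[FY FZ GY GZ].
rewrite FF FG GF GG YY YZ ZY ZZ FY FZ GY GZ.
by rewrite !(gram_sym0 FY, gram_sym0 FZ, gram_sym0 GY, gram_sym0 GZ)
           !block_mx0 -!scalar_mx_block.
Qed.

(** * The singular vectors occurring in pairs *)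

Section PairedBasis.
Variables (R : realType) (n nu mu : nat) (A : 'M[R[i]]_n) (sigma : nu.-tuple R).
Local Notation C := R[i].
Local Notation P := (A ^t* *m A).
Local Notation J := (conjact A).

Definition paired_values (S : 'M[C]_nu) : 'M[C]_(nu + mu) :=
  block_mx S 0 0 1%:M.

Lemma mxconj_paired S :
  mxconj S = S -> mxconj (paired_values S) = paired_values S.
Proof. by move=> rS; rewrite map_block_mx !map_mx0 map_mx1 rS. Qed.

Lemma gt1_tnth :
  sigma = [seq s <- singular_values A | 1 < s] :> seq R ->
  forall j, 1 < tnth sigma j.
Proof.
move=> hs j; have := mem_tnth j sigma.
rewrite -[_ \in tval _]/(_ \in (sigma : seq R)) hs.
by rewrite mem_filter => /andP[].
Qed.

Lemma mxconj_mxS : mxconj (mxS sigma) = mxS sigma.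
Proof.
rewrite map_diag_mx; congr diag_mx; apply/matrixP => i j.
by rewrite !mxE /= conj_Creal // complex_real.
Qed.

Lemma mxS_unit : (forall j, 1 < tnth sigma j) -> mxS sigma \in unitmx.
Proof.
move=> h; rewrite unitmxE det_diag unitfE; apply/prodf_neq0 => j _.
by rewrite mxE fmorph_eq0 gt_eqF // (lt_trans ltr01).
Qed.

Lemma invmx_mxS : (forall j, 1 < tnth sigma j) ->
  invmx (mxS sigma) = diag_mx (\row_j ((tnth sigma j)%:C)^-1).
Proof.
move=> h; rewrite -[RHS]mul1mx -(mulVmx (mxS_unit h)) -mulmxA mulmx_diag.
rewrite (_ : diag_mx _ = 1%:M) ?mulmx1 // -diag_const_mx; congr diag_mx.
apply/matrixP => i j; rewrite !mxE divff //.
by rewrite fmorph_eq0 gt_eqF // (lt_trans ltr01).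
Qed.

(** The matrix B collects all the eigenvectors of A^H A of eigenvalue > 1, their
    images under J, and the given pairs.  The last two conclusions are what
    [fixed_orthonormal_completion] asks of B. *)
Lemma paired_singular_basis (U V : 'M[C]_(n, mu)) :
  coninvolutory A ->
  sigma = [seq s <- singular_values A | 1 < s] :> seq R ->
  A *m V = U -> A ^t* *m U = V ->
  (row_mx V (mxconj U)) ^t* *m row_mx V (mxconj U) = 1%:M ->
  exists V1 G1 : 'M[C]_(n, nu),
    let F := row_mx V1 V in let G := row_mx G1 (mxconj U) in
    let B := row_mx F G in
    [/\ B ^t* *m B = 1%:M, J F = G *m paired_values (mxS sigma),
        J G = F *m paired_values (invmx (mxS sigma)),
        (exists K, P *m J B = B *m K) &
        forall y : 'cV[C]_n, B ^t* *m y = 0 -> P *m y = y].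
Proof.
move=> hA hs hV hU; rewrite gram_row scalar_mx_block => /eq_block_mx.
move=> [VV VU UV UU].
have s1 := gt1_tnth hs.
have [E [d [EE hE d0 hchar]]] := gram_spectral A.
have [f [injf df fd]] := gt1_singular_index hs d0 hchar.
set S := mxS sigma; set T := invmx S.
have uS : S \in unitmx by apply: mxS_unit.
pose V1 := colsub f E.
have V1V1 : V1 ^t* *m V1 = 1%:M.
  apply/matrixP => i j; transitivity ((E ^t* *m E) (f i) (f j)).
    by rewrite !mxE; apply: eq_bigr => k _; rewrite !mxE.
  by rewrite EE !mxE (inj_eq injf).
have PV1' : P *m V1 = V1 *m diag_mx (\row_j ((tnth sigma j)%:C ^+ 2)).
  apply/matrixP => i j; transitivity ((P *m E) i (f j)).
    rewrite !mxE; apply: eq_bigr => k _.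
    by rewrite [in RHS]mxE [in LHS]mxE !mxE.
  by rewrite hE !mul_mx_diag !mxE df.
have PV1 : P *m V1 = V1 *m S *m S.
  rewrite PV1' -mulmxA mulmx_diag; congr (_ *m diag_mx _).
  by apply/matrixP => i j; rewrite !mxE expr2.
have ST : S *m T = 1%:M := mulmxV uS.
have rS : mxconj S = S := mxconj_mxS.
have rT : mxconj T = T by rewrite /T map_invmx rS.
have sT : T ^T = T by rewrite /T invmx_mxS // tr_diag_mx.
have PV : P *m V = V by rewrite -mulmxA hV hU.
have JV : J V = mxconj U by rewrite /conjact hV.
have [G1 G1E] : exists G1, G1 = J V1 *m T by exists (J V1 *m T).
have [_ _ PJV1 _ _] := conjact_rescaled hA V1V1 PV1 ST rS rT sT G1E.
have PG1 : P *m G1 = G1 *m diag_mx (\row_j ((tnth sigma j)%:C ^- 2)).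
  rewrite {1}G1E mulmxA PJV1 -mulmxA /T invmx_mxS // mulmx_diag.
  congr (_ *m diag_mx _); apply/matrixP => i j.
  by rewrite !mxE -invfM expr2.
have PU : P *m mxconj U = mxconj U *m diag_mx (const_mx 1).
  by rewrite diag_const_mx mulmx1 -JV -{1}PV gram_conjact_gram.
have PVd : P *m V = V *m diag_mx (const_mx 1).
  by rewrite diag_const_mx mulmx1.
have hP := herm_gram A.
have r2 (i : 'I_nu) :
    (\row_j ((tnth sigma j)%:C ^+ 2) : 'rV[C]_nu) 0 i \is Num.real.
  by rewrite mxE rpredX // complex_real.
have r1 (i : 'I_mu) : (const_mx 1 : 'rV[C]_mu) 0 i \is Num.real.
  by rewrite mxE.
have sq1 j : 1 < (tnth sigma j)%:C ^+ 2 :> C.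
  by rewrite exprn_egt1 // -[1]/(1%:C) ltcR.
(* P-eigenvalues: sigma_j^2 > 1 on V1, sigma_j^-2 < 1 on G1, and 1 on V and
   conj U; blocks with distinct eigenvalues are orthogonal. *)
have V1V : V1 ^t* *m V = 0.
  apply: (eigen_perp hP r2 PV1' PVd) => i j; rewrite !mxE.
  by rewrite gt_eqF.
have V1G1 : V1 ^t* *m G1 = 0.
  apply: (eigen_perp hP r2 PV1' PG1) => i j; rewrite !mxE.
  rewrite gt_eqF // (lt_trans _ (sq1 i)) // invf_lt1 ?sq1 //.
  exact: lt_trans ltr01 (sq1 j).
have V1U : V1 ^t* *m mxconj U = 0.
  apply: (eigen_perp hP r2 PV1' PU) => i j; rewrite !mxE.
  by rewrite gt_eqF.
have VG1 : V ^t* *m G1 = 0.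
  apply: (eigen_perp hP r1 PVd PG1) => i j; rewrite !mxE.
  rewrite gt_eqF // invf_lt1 ?sq1 //.
  exact: lt_trans ltr01 (sq1 j).
have FF : (row_mx V1 V) ^t* *m row_mx V1 V = 1%:M.
  by rewrite gram_row V1V1 V1V (gram_sym0 V1V) VV -scalar_mx_block.
have FG : (row_mx V1 V) ^t* *m row_mx G1 (mxconj U) = 0.
  by rewrite gram_row V1G1 V1U VG1 VU block_mx0.
have PF : P *m row_mx V1 V =
    row_mx V1 V *m paired_values S *m paired_values S.
  rewrite mul_mx_row PV PV1 /paired_values !mul_row_block.
  by rewrite !mulmx0 !mulmx1 !addr0 !add0r.
have LL' : paired_values S *m paired_values T = 1%:M.
  rewrite /paired_values mulmx_block !mulmx0 !mul0mx !mulmx1 ST.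
  by rewrite !addr0 !add0r -scalar_mx_block.
have rL : mxconj (paired_values S) = paired_values S := mxconj_paired rS.
have rL' : mxconj (paired_values T) = paired_values T := mxconj_paired rT.
have sL' : (paired_values T) ^T = paired_values T.
  by rewrite /paired_values tr_block_mx !trmx0 trmx1 sT.
have GE : row_mx G1 (mxconj U) = J (row_mx V1 V) *m paired_values T.
  rewrite conjact_row JV mul_row_block G1E.
  by rewrite !mulmx0 !mulmx1 !addr0 !add0r.
have [JF JG PJF PJG GG] := conjact_rescaled hA FF PF LL' rL rL' sL' GE.
exists V1, G1 => F G B.
have hB : P *m J B = B *m block_mx 0 (paired_values S) (paired_values T) 0.
  rewrite conjact_row mul_mx_row PJF PJG (mul_row_block F G).
  by rewrite !mulmx0 addr0 add0r.
split=> //.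
- by rewrite (gram_row F G) FF FG (gram_sym0 FG) GG -scalar_mx_block.
- by exists (block_mx 0 (paired_values S) (paired_values T) 0).
apply: (gram_perp_id hA hB) => y hy; apply: (perp_quad_leif EE hE d0) => i.
move=> /fd[j <-]; have [/row_perp[+ _] _] := row_perp hy.
move=> /matrixP/(_ j 0); rewrite [RHS]mxE => <-; rewrite !mxE.
by apply: eq_bigr => k _; rewrite !mxE.
Qed.

End PairedBasis.

(** * The canonical form *)

Lemma mxT_mul_Sigma (R : realType) nu mu delta eta
  (S : 'M[R[i]]_nu) (D : 'M[R[i]]_delta) (E : 'M[R[i]]_eta) :
  mxT nu mu D E *m mxSigma mu delta eta S = mxTSigma mu S D E.
Proof.
rewrite /mxT /mxSigma /mxTSigma !mulmx_block.
by rewrite !(mulmx0, mul0mx, mulmx1, mul1mx, addr0, add0r, block_mx0).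
Qed.

Lemma mxTSigma_coninvolutory (R : realType) nu mu delta eta (S : 'M[R[i]]_nu) :
  S \in unitmx -> mxconj S = S ->
  coninvolutory (mxTSigma mu S (1%:M : 'M[R[i]]_delta) (1%:M : 'M[R[i]]_eta)).
Proof.
move=> uS rS; rewrite /coninvolutory /mxTSigma !map_block_mx.
rewrite !(map_mx0, map_mx1) map_invmx rS !mulmx_block.
rewrite !(mulmx0, mul0mx, mulmx1, mul1mx, addr0, add0r, block_mx0).
by rewrite !add_block_mx !addr0 !add0r mulVmx // mulmxV // -!scalar_mx_block.
Qed.

Lemma phases0 (R : realType) delta eta (alpha : 'I_(delta + eta) -> R) :
  (forall j, alpha j = 0) -> phasesD alpha = 1%:M /\ phasesE alpha = 1%:M.
Proof.
move=> h; rewrite /phasesD /phasesE; split; rewrite -diag_const_mx;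
  by congr diag_mx; apply/matrixP => i j; rewrite !mxE h /expi cos0 sin0.
Qed.

Lemma mulmx_col (C : numClosedFieldType) m n p (X : 'M[C]_(m, n))
  (Y : 'M[C]_(n, p)) j : X *m col j Y = col j (X *m Y).
Proof. by rewrite !colE mulmxA. Qed.

Lemma col_gram (C : numClosedFieldType) n p q (X : 'M[C]_(n, p))
  (Y : 'M[C]_(n, q)) i j : (col i X) ^t* *m col j Y = ((X ^t* *m Y) i j)%:M.
Proof.
rewrite [LHS]mx11_scalar; congr (_%:M); rewrite !mxE.
by apply: eq_bigr => k _; rewrite !mxE.
Qed.

Lemma gram_cols (C : numClosedFieldType) n p q (X : 'M[C]_(n, p))
  (Y : 'M[C]_(n, q)) (M : 'M[C]_(p, q)) :
  (forall i j, (col i X) ^t* *m col j Y = (M i j)%:M) -> X ^t* *m Y = M.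
Proof.
move=> h; apply/matrixP => i j; have := h i j; rewrite col_gram.
by move=> /matrixP/(_ 0 0); rewrite !mxE eqxx !mulr1n.
Qed.

Lemma orthonormal_join_cols (R : realType) (I : eqType) n q
  (x : I -> 'cV[R[i]]_n) (Y : 'M[R[i]]_(n, q)) :
  orthonormal_fam x -> (forall i, (x i) ^t* *m Y = 0) -> Y ^t* *m Y = 1%:M ->
  orthonormal_fam (join_fam x (fun j => col j Y)).
Proof.
move=> hx hxY hY.
have col0 i j : (x i) ^t* *m col j Y = 0.
  by rewrite -[x i](col_id 0) col_gram hxY mxE raddf0.
case=> i [] j /=; first exact: hx.
- by rewrite col0 raddf0.
- by rewrite (gram_sym0 (col0 j i)) raddf0.
- by rewrite col_gram hY mxE.
Qed.

Theorem corollary8 (R : realType) (n m nu mu eta delta : nat) (A : 'M[R[i]]_n)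
  (sigma : nu.-tuple R) (u v : 'I_mu -> 'cV[R[i]]_n)
  (hA : coninvolutory A)
  (hsigma : sigma = [seq s <- singular_values A | 1 < s] :> seq R)
  (huv : forall j, singular_triplet A (u j) (v j) 1 /\
                   singular_triplet A (mxconj (v j)) (mxconj (u j)) 1)
  (horth : orthonormal_fam (join_fam v (fun j => mxconj (u j))))
  (heta : eta = (m - nu - mu)%N)
  (hn : (n = m.*2 /\ delta = eta) \/ (n = m.*2.+1 /\ delta = eta.+1)) :
  (exists (alpha : 'I_(delta + eta) -> R) (w : 'I_(delta + eta) -> 'cV[R[i]]_n)
          (hdim : (nu + mu + delta + (nu + mu + eta))%N = n),
    let S := mxS sigma in
    let D := phasesD alpha in
    let E := phasesE alpha in
    let T := mxT nu mu D E in
    let Sigma := mxSigma mu delta eta S in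
    [/\ (forall j, singular_triplet A (w j) (expi (alpha j) *: mxconj (w j)) 1),
        orthonormal_fam (join_fam (join_fam v (fun j => mxconj (u j)))
                              (fun j => expi (alpha j) *: mxconj (w j))),
        T *m Sigma = mxTSigma mu S D E,
        coninvolutory (T *m Sigma) &
        unitarily_consimilar A (castmx (hdim, hdim) (T *m Sigma))]) /\
  consimilar A 1%:M.
Proof.
split; last exact: coninvolutory_consimilar1.
pose V : 'M[R[i]]_(n, mu) := \matrix_(i, j) v j i 0.
pose U : 'M[R[i]]_(n, mu) := \matrix_(i, j) u j i 0.
have colV j : col j V = v j by apply/matrixP => i k; rewrite !mxE ord1.
have colU j : col j U = u j by apply/matrixP => i k; rewrite !mxE ord1.
have colUc j : col j (mxconj U) = mxconj (u j) by rewrite -map_col colU.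
have AV : A *m V = U.
  apply/matrixP => i j; have [[_ _ _ + _] _] := huv j.
  rewrite scale1r -colV -colU => /matrixP/(_ i 0).
  by rewrite mulmx_col !mxE.
have AU : A ^t* *m U = V.
  apply/matrixP => i j; have [[_ _ _ _ +] _] := huv j.
  rewrite scale1r -colV -colU => /matrixP/(_ i 0).
  by rewrite mulmx_col !mxE.
have VU : (row_mx V (mxconj U)) ^t* *m row_mx V (mxconj U) = 1%:M.
  rewrite gram_row scalar_mx_block; congr block_mx; apply: gram_cols => i j;
    rewrite ?colV ?colUc.
  - by have /= -> := horth (inl i) (inl j); rewrite mxE.
  - by have /= -> := horth (inl i) (inr j); rewrite mxE.
  - by have /= -> := horth (inr i) (inl j); rewrite mxE.
  - by have /= -> := horth (inr i) (inr j); rewrite mxE.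
have [V1 [G1]] := paired_singular_basis hA hsigma AV AU VU.
set F := row_mx V1 V; set G := row_mx G1 (mxconj U); set B := row_mx F G.
move=> [BB JF JG [K hK] perp].
have leBn : (nu + mu + (nu + mu) <= n)%N.
  have uB : B ^t* \is unitarymx by apply/unitarymxP; rewrite trmxCK.
  by rewrite -(mxrank_unitary uB) rank_leq_col.
have hr : (nu + mu + (nu + mu) + (delta + eta))%N = n by lia.
have hdim : (nu + mu + delta + (nu + mu + eta))%N = n by lia.
have [Y [BY YY JY]] := fixed_orthonormal_completion hA hr BB hK perp.
pose alpha (j : 'I_(delta + eta)) : R := 0.
have expi0 j : expi (alpha j) = 1 by rewrite /expi cos0 sin0.
have [hD hE] : phasesD alpha = 1%:M /\ phasesE alpha = 1%:M by exact: phases0.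
have s1 := gt1_tnth hsigma.
have [/row_perp[_ VY] /row_perp[_ UY]] := row_perp BY.
exists alpha, (fun j => mxconj (col j Y)), hdim.
move=> S D E T Sigma; rewrite /T /Sigma mxT_mul_Sigma /D /E hD hE; split=> //.
- move=> j; have JYj : conjact A (col j Y) = col j Y.
    by rewrite /conjact mulmx_col map_col -/(conjact A Y) JY.
  have YYj : (col j Y) ^t* *m col j Y = 1%:M by rewrite col_gram YY mxE eqxx.
  have AYj : A *m col j Y = mxconj (col j Y) by rewrite -[in RHS]JYj mxconjK.
  rewrite expi0 scale1r mxconjK; split=> //.
  - by rewrite -mxconj_trmxC -map_mxM YYj map_mx1.
  - by rewrite AYj scale1r.
  - rewrite scale1r -AYj mulmxA; apply: perp.
    by rewrite mulmx_col BY col0.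
- have -> : (fun j => expi (alpha j) *: mxconj (mxconj (col j Y))) =
            (fun j => col j Y).
    by apply/funext => j; rewrite expi0 scale1r mxconjK.
  apply: orthonormal_join_cols => // -[] j /=.
  - by rewrite -colV tr_col map_row -row_mul VY row0.
  - by rewrite -colUc tr_col map_row -row_mul UY row0.
- by apply: mxTSigma_coninvolutory; [apply: mxS_unit | apply: mxconj_mxS].
clear hr; subst n; rewrite /unitarily_consimilar castmx_id.
have [JY1 JY2] : conjact A (lsubmx Y) = lsubmx Y /\
                 conjact A (rsubmx Y) = rsubmx Y.
  by apply: eq_row_mx; rewrite -conjact_row hsubmxK.
have rS := mxconj_mxS sigma.
apply: (unitary_consimilar_swap JF JG JY1 JY2).
- exact: mxconj_paired.
- by apply: mxconj_paired; rewrite map_invmx rS.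
by apply: gram_interleave; rewrite ?hsubmxK.
Qed.
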